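(* Let $K$ be the Cartesian product $H_1\times\dots\times H_k$ of frames $H_i=(T_i,U_i)$, $i=1,\dots,k$. Let $K'$ be an isometric subgraph of $K$ such that $K'$ is modular and, for each $i=1,\dots,k$, some $i$-layer of $K'$ is isomorphic to $H_i$. Then there exists a retraction of $K$ onto $K'$.
   Context: All graphs are finite and connected; $d^G$ denotes the path metric of a graph $G$. A graph $G$ is modular if every three nodes $x,y,z$ have a median, a node $v$ with $d^G(x,v)+d^G(v,y)=d^G(x,y)$, $d^G(y,v)+d^G(v,z)=d^G(y,z)$, $d^G(x,v)+d^G(v,z)=d^G(x,z)$. A subgraph $G'$ of $G$ is isometric if $d^{G'}(s,t)=d^G(s,t)$ for all nodes $s,t$ of $G'$. $G$ is hereditary modular if every isometric subgraph is modular. $G$ is orientable if its edges can be oriented so that in every 4-circuit opposite edges are oriented in opposite directions around the circuit (i.e., for every 4-circuit $v_0v_1v_2v_3v_0$, the edge $v_0v_1$ is oriented from $v_0$ to $v_1$ iff $v_2v_3$ is oriented from $v_3$ to $v_2$, and $v_1v_2$ is oriented from $v_1$ to $v_2$ iff $v_3v_0$ is oriented from $v_0$ to $v_3$). A frame is an orientable hereditary modular graph. The Cartesian product $H_1\times\dots\times H_k$ has node set $T_1\times\dots\times T_k$, with $(s_1,\dots,s_k)$ and $(t_1,\dots,t_k)$ adjacent iff for some $i$, $s_it_i\in U_i$ and $s_j=t_j$ for all $j\ne i$. For a subgraph $K'$ of $K$ and $i\in\{1,\dots,k\}$, an $i$-layer of $K'$ is a maximal subgraph of $K'$ induced by nodes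 $(t_1,\dots,t_k)$ with all coordinates other than $t_i$ fixed. A retraction of a bipartite graph $K$ onto its subgraph $K'$ is a map $\gamma:V(K)\to V(K')$ with $\gamma(v)=v$ for $v\in V(K')$ and $\gamma(u)\gamma(v)\in E(K')$ for every edge $uv\in E(K)$. *)

(* Defs.v *)
(* MathComp world. *)
From HB Require Import structures.
From mathcomp Require Import all_boot.

Set Implicit Arguments.
Unset Strict Implicit.
Unset Printing Implicit Defensive.

(* The node set is a subset of an ambient finite type, so that a graph and its
   (not necessarily induced) subgraphs live over the same type.  Connectedness
   is the separate predicate [connected_graph]. *)
Record graph (T : finType) := Graph {
  nodes : {set T};
  edge : rel T;
  edge_sym : symmetric edge;
  edge_irr : irreflexive edge;
  edge_nodes : forall x y, edge x y -> x \in nodes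
}.

Section Graphs.
Variable T : finType.
Implicit Types (G : graph T) (x y z v : T).

Definition connected_graph G : Prop :=
  nodes G != set0 /\ {in nodes G &, forall x y, connect (edge G) x y}.

Definition walk G n x y : bool :=
  [exists p : n.-tuple T, path (edge G) x p && (last x p == y)].

(* The path metric: the least length of a walk from x to y.  A shortest walk
   repeats no node, so lengths below #|T| suffice; if x and y are not joined by
   any walk the value is #|T|. *)
Definition dist G x y : nat := find (fun n => walk G n x y) (iota 0 #|T|).

Lemma walkP G n x y :
  reflect (exists p, [/\ path (edge G) x p, last x p = y & size p = n])
          (walk G n x y).
Proof.
apply: (iffP existsP) => [[p /andP[pp /eqP lp]]|[p [pp lp sp]]].
  by exists p; rewrite size_tuple.
by move/eqP: sp => sp; exists (Tuple sp); rewrite /= pp lp eqxx.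
Qed.

Lemma dist_min G n x y : walk G n x y -> dist G x y <= n.
Proof.
move=> w; case: (ltnP n #|T|) => [ltn|gen]; last first.
  by apply: leq_trans gen; rewrite -[X in _ <= X](size_iota 0) find_size.
rewrite leqNgt; apply/negP => /(before_find 0).
by rewrite nth_iota // add0n w.
Qed.

Lemma walk_dist G x y : connect (edge G) x y -> walk G (dist G x y) x y.
Proof.
case/connectP=> p0 /shortenP[p pp up _] ->.
set w := fun n => walk G n x (last x p).
have hw : has w (iota 0 #|T|).
  apply/hasP; exists (size p); last by apply/walkP; exists p.
  by rewrite mem_iota /= add0n; have/card_uniqP/= <- := up; apply: max_card.
move: (hw); rewrite has_find size_iota => ltf.
by have := nth_find 0 hw; rewrite nth_iota.
Qed.

Definition median G x y z v : bool :=
  [&& dist G x v + dist G v y == dist G x y,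
      dist G y v + dist G v z == dist G y z
    & dist G x v + dist G v z == dist G x z].

Definition modular G : Prop :=
  {in nodes G & &, forall x y z, exists2 v, v \in nodes G & median G x y z v}.

Definition subgraph (G' G : graph T) : Prop :=
  nodes G' \subset nodes G /\ subrel (edge G') (edge G).

Definition isometric_subgraph (G' G : graph T) : Prop :=
  [/\ connected_graph G', subgraph G' G
    & {in nodes G' &, forall s t, dist G' s t = dist G s t}].

Definition hereditary_modular G : Prop :=
  forall G', isometric_subgraph G' G -> modular G'.

(* [o x y] means that the edge xy is oriented from x to y. *)
Definition orientation G (o : rel T) : Prop :=
  subrel o (edge G) /\ forall x y, edge G x y -> o x y (+) o y x.

Definition orientable G : Prop :=
  exists2 o, orientation G o &
    forall v0 v1 v2 v3,
      uniq [:: v0; v1; v2; v3] -> cycle (edge G) [:: v0; v1; v2; v3] ->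
      o v0 v1 = o v3 v2 /\ o v1 v2 = o v0 v3.

Definition frame G : Prop :=
  [/\ connected_graph G, orientable G & hereditary_modular G].

Definition retraction (K K' : graph T) (g : T -> T) : Prop :=
  [/\ {in nodes K, forall v, g v \in nodes K'},
      {in nodes K', forall v, g v = v}
    & forall u v, edge K u v -> edge K' (g u) (g v)].

Section Induced.
Variables (G : graph T) (A : {set T}).

Let ind_edge : rel T := fun x y => [&& edge G x y, x \in A & y \in A].

Fact ind_edge_sym : symmetric ind_edge.
Proof. by move=> x y; rewrite /ind_edge edge_sym [(x \in A) && _]andbC. Qed.

Fact ind_edge_irr : irreflexive ind_edge.
Proof. by move=> x; rewrite /ind_edge edge_irr. Qed.

Fact ind_edge_nodes x y : ind_edge x y -> x \in nodes G :&: A.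
Proof. by case/and3P=> /edge_nodes xG xA _; rewrite inE xG. Qed.

Definition induced : graph T := Graph ind_edge_sym ind_edge_irr ind_edge_nodes.

End Induced.

End Graphs.

Definition isomorphic (T1 T2 : finType) (G : graph T1) (H : graph T2) : Prop :=
  exists f : T1 -> T2,
    [/\ {in nodes G &, injective f}, f @: nodes G = nodes H
      & {in nodes G &, {mono f : x y / edge G x y >-> edge H x y}}].

Section Product.
Variables (k : nat) (T : 'I_k -> finType).

Local Notation point := {dffun forall i : 'I_k, T i}.

Definition agree_off (i : 'I_k) (s t : point) : bool :=
  [forall j, (j != i) ==> (s j == t j)].

Section CartesianProduct.
Variable H : forall i, graph (T i).

Let prod_nodes : {set point} := setXn (fun i => nodes (H i)).

Let prod_edge : rel point := fun s t =>
  [&& s \in prod_nodes, t \in prod_nodes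
    & [exists i, edge (H i) (s i) (t i) && agree_off i s t]].

Fact prod_edge_sym : symmetric prod_edge.
Proof.
move=> s t; rewrite /prod_edge andbCA; do 2!congr (_ && _).
apply: eq_existsb => i; rewrite edge_sym; congr andb.
by apply: eq_forallb => j; rewrite [s j == _]eq_sym.
Qed.

Fact prod_edge_irr : irreflexive prod_edge.
Proof.
move=> s; apply/negP=> /and3P[_ _ /existsP[i]].
by rewrite edge_irr.
Qed.

Fact prod_edge_nodes s t : prod_edge s t -> s \in prod_nodes.
Proof. by case/and3P. Qed.

Definition cartesian_product : graph point :=
  Graph prod_edge_sym prod_edge_irr prod_edge_nodes.

End CartesianProduct.

(* The i-layer of K' through t. *)
Definition layer (K' : graph point) (i : 'I_k) (t : point) : graph point :=
  induced K' [set s | agree_off i s t].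

End Product.

(* Main.v *)
Require Import Defs.
From mathcomp Require Import all_boot zify.

(** Fix a base node in each frame.  Since a frame has no isometric 6-cycle and, by
    orientability, no [K_{3,3}] minus an edge, the neighbours of a node [s] lying
    below it have a common neighbour below them, unique as soon as there are two of
    them; [descend s] is this node, or the only neighbour below [s].

    Medians with full layers show that the projection [B] of [K'] to two factors
    is closed: its rows and columns are down-closed, and contain a node as soon as
    they contain two neighbours below it.  The relation
    [B (descend s) t && B s (descend t)] is again closed, and retracts onto [B] by an
    explicit map moving both coordinates of a pair outside [B] down by the same
    number (1 or 2) of steps.  Iterating this enlargement of [B] exhausts the product
    of the two factors.

    Now take an idempotent edge-preserving self-map of [K] fixing [K'], with
    image [R].  If a projection of [R] to two factors is not contained in that of
    [K'], consider the first iterate which covers it: the map above sends two nodes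
    of [R] differing in these two coordinates only to the same node, so that
    composing with it gives a smaller image.  Otherwise [R] is contained in [K'],
    since, by medians, membership in [K'] depends on pairs of coordinates only. *)

Set Implicit Arguments.
Unset Strict Implicit.
Unset Printing Implicit Defensive.

(** * Path metric *)

Section PathMetric.
Variables (T : finType) (G : graph T).
Hypothesis conG : connected_graph G.
Local Notation d := (dist G).
Local Notation N := (nodes G).

Lemma edge_nodesr x y : edge G x y -> y \in N.
Proof. by rewrite edge_sym => /edge_nodes. Qed.

Lemma dist_walk x y : x \in N -> y \in N -> walk G (d x y) x y.
Proof. by move=> xN yN; apply/walk_dist/(proj2 conG). Qed.

Lemma distxx x : d x x = 0.
Proof. by apply/eqP; rewrite -leqn0 dist_min //; apply/walkP; exists [::]. Qed.

Lemma dist_eq0 x y : x \in N -> y \in N -> d x y = 0 -> x = y.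
Proof.
move=> xN yN d0; have := dist_walk xN yN; rewrite d0 => /walkP[p [_ <-]].
by move/size0nil=> ->.
Qed.

Lemma walk_sym n x y : walk G n x y -> walk G n y x.
Proof.
case/walkP=> p [pp <- sp]; apply/walkP; exists (rev (belast x p)); split.
- by rewrite rev_path (eq_path (e' := edge G)) // => u v; rewrite edge_sym.
- by case: p {pp sp} => //= z p; rewrite rev_cons last_rcons.
- by rewrite size_rev size_belast.
Qed.

Lemma distC x y : x \in N -> y \in N -> d x y = d y x.
Proof.
move=> xN yN; apply/eqP; rewrite eqn_leq.
by rewrite !dist_min //; apply/walk_sym/dist_walk.
Qed.

Lemma walk_cat m n x y z : walk G m x y -> walk G n y z -> walk G (m + n) x z.
Proof.
case/walkP=> p [pp lp sp] /walkP[q [pq lq sq]]; apply/walkP; exists (p ++ q).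
by rewrite cat_path last_cat lp pp pq lq size_cat sp sq.
Qed.

Lemma dist_triangle x y z :
  x \in N -> y \in N -> z \in N -> d x z <= d x y + d y z.
Proof.
by move=> xN yN zN; apply/dist_min/(@walk_cat _ _ _ y); apply: dist_walk.
Qed.

Lemma walk1 x y : walk G 1 x y = edge G x y.
Proof.
apply/walkP/idP => [[[|z [|? ?]] [] //= /andP[exz _] <- //]|exy].
by exists [:: y]; rewrite /= exy.
Qed.

Lemma edge_neq x y : edge G x y -> x != y.
Proof. by move=> exy; apply/eqP=> eq_xy; rewrite eq_xy edge_irr in exy. Qed.

Lemma dist1 x y : x \in N -> y \in N -> (d x y == 1) = edge G x y.
Proof.
move=> xN yN; apply/eqP/idP => [d1|exy].
  by rewrite -walk1 -d1 dist_walk.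
have: d x y <= 1 by apply: dist_min; rewrite walk1.
case: (d x y) (dist_eq0 xN yN) => [/(_ erefl) eq_xy|[|]//] _.
by move: exy; rewrite eq_xy edge_irr.
Qed.

Lemma dist_edge x y : edge G x y -> d x y = 1.
Proof.
by move=> exy; apply/eqP; rewrite dist1 ?(edge_nodes exy) ?(edge_nodesr exy).
Qed.

Lemma dist_step x y : x \in N -> y \in N -> x != y ->
  exists2 z, edge G x z & d x y = (d z y).+1.
Proof.
move=> xN yN nxy; have /walkP[p [pp lp sp]] := dist_walk xN yN.
case: p pp lp sp => [_ /= eq_xy|z p /= /andP[exz pp] lp sp].
  by rewrite eq_xy eqxx in nxy.
have zN := edge_nodesr exz; exists z => //.
have: d z y <= size p by apply: dist_min; apply/walkP; exists p.
by have := dist_triangle xN zN yN; rewrite (dist_edge exz); lia.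
Qed.

(** Adding the two equations of the median that involve [z] gives [d x y + 2 * d v z = d x y]. *)
Lemma median_between x y z v : x \in N -> y \in N -> z \in N -> v \in N ->
  median G x y z v -> d x z + d z y = d x y -> v = z.
Proof.
move=> xN yN zN vN /and3P[/eqP m1 /eqP m2 /eqP m3] bz; apply: dist_eq0 => //.
have := dist_triangle xN vN zN; have := dist_triangle yN vN zN.
rewrite (distC zN yN) in bz; rewrite (distC vN yN) in m1. 
lia.
Qed.

End PathMetric.

(** * Modular graphs and frames *)

Section Modular.
Variables (T : finType) (G : graph T).
Hypotheses (conG : connected_graph G) (modG : modular G).
Local Notation d := (dist G).
Local Notation N := (nodes G).

(** The median of [p] and the two ends of an edge is one of these ends; in particular a modular
    graph is bipartite. *)
Lemma edge_level p x y : p \in N -> edge G x y ->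
  d p y = (d p x).+1 \/ d p x = (d p y).+1.
Proof.
move=> pN exy; have [xN yN] := (edge_nodes exy, edge_nodesr exy).
have [v vN /and3P[/eqP m1 /eqP m2 /eqP m3]] := modG pN xN yN.
have d1 := dist_edge conG exy; rewrite d1 in m2.
have [d0|d0] : d x v = 0 \/ d v y = 0 by lia.
  by rewrite -(dist_eq0 conG xN vN d0) d1 in m3; lia.
by rewrite (dist_eq0 conG vN yN d0) (distC conG yN xN) d1 in m1; lia.
Qed.

Lemma dist2_lb x y z : edge G x y -> edge G y z -> x != z -> 1 < d x z.
Proof.
move=> exy eyz nxz; have [xN zN] := (edge_nodes exy, edge_nodesr eyz).
have := edge_level xN eyz; rewrite (dist_edge conG exy).
by case=> [-> // | [d0]]; rewrite (dist_eq0 conG xN zN (esym d0)) eqxx in nxz.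
Qed.

Lemma dist2 x y z : edge G x y -> edge G y z -> x != z -> d x z = 2.
Proof.
move=> exy eyz nxz; apply/eqP; rewrite eqn_leq (dist2_lb exy eyz) // andbT.
by rewrite dist_min //; apply: (@walk_cat _ _ 1 1 _ y); rewrite walk1.
Qed.

Lemma dist3_lb x y z w : edge G x y -> edge G y z -> edge G z w ->
  ~~ edge G x w -> 2 < d x w.
Proof.
move=> exy eyz ezw nxw; have [xN wN] := (edge_nodes exy, edge_nodesr ezw).
have nxz : x != z by apply: contraNneq nxw => ->.
have := dist2 exy eyz nxz; have := edge_level xN ezw.
by move: nxw; rewrite -(dist1 conG) //; lia.
Qed.

End Modular.

(** * Subgraphs excluded from a frame *)

Section Frame.
Variables (T : finType) (G : graph T).
Hypothesis frameG : frame G.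
Local Notation d := (dist G).
Local Notation N := (nodes G).

Lemma frame_connected : connected_graph G. Proof. by case: frameG. Qed.
Let conG := frame_connected.

Lemma frame_modular : modular G.
Proof. by case: frameG => conG' _; apply; split=> //; split. Qed.
Let modG := frame_modular.

(** Without a long diagonal the six nodes induce an isometric subgraph, which is then modular. But
    [a0], [a2], [a4] are pairwise at distance 2, so their median would be a common neighbour among
    the six, and hence the end of a long diagonal. A coincidence such as [a0 = a2] already produces
    a diagonal. *)
Lemma frame_no_hexagon a0 a1 a2 a3 a4 a5 :
    edge G a0 a1 -> edge G a1 a2 -> edge G a2 a3 ->
    edge G a3 a4 -> edge G a4 a5 -> edge G a5 a0 ->
  [|| edge G a0 a3, edge G a1 a4 | edge G a2 a5].
Proof.
move=> e01 e12 e23 e34 e45 e50; apply/negPn/negP; rewrite !negb_or.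
case/and3P=> n03 n14 n25.
have [a0N a1N a2N] := And3 (edge_nodes e01) (edge_nodes e12) (edge_nodes e23).
have [a3N a4N a5N] := And3 (edge_nodes e34) (edge_nodes e45) (edge_nodes e50).
pose S := [set x in [:: a0; a1; a2; a3; a4; a5]]; pose G' := induced G S.
have SN x : x \in S -> x \in N.
  by rewrite inE !in_cons in_nil orbF; do 5?[case/orP]; move/eqP->.
have nodesG' : nodes G' = S by apply/setIidPr/subsetP.
have edgeG' x y : edge G x y -> x \in S -> y \in S -> edge G' x y.
  by move=> exy xS yS; apply/and3P.
have S0 : a0 \in S by rewrite !inE eqxx ?orbT.
have S1 : a1 \in S by rewrite !inE eqxx ?orbT.
have S2 : a2 \in S by rewrite !inE eqxx ?orbT.
have S3 : a3 \in S by rewrite !inE eqxx ?orbT.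
have S4 : a4 \in S by rewrite !inE eqxx ?orbT.
have S5 : a5 \in S by rewrite !inE eqxx ?orbT.
have even2 := dist2_lb conG modG; have odd3 := dist3_lb conG modG.
(* Two of the nodes are joined by at most three steps of the closed walk. This walk is shortest in
   [G]: parity excludes length 1 for two steps, and the missing diagonal excludes it for three. *)
have short x y : x \in S -> y \in S -> exists2 n, walk G' n x y & n <= d x y.
  have w0 x' : x' \in S -> exists2 n, walk G' n x' x' & n <= d x' x'.
    by exists 0 => //; apply/walkP; exists [::].
  have w1 x' y' : edge G x' y' -> x' \in S -> y' \in S ->
    exists2 n, walk G' n x' y' & n <= d x' y'.
    move=> e xS yS; exists 1; first by rewrite walk1 edgeG'.
    by rewrite (dist_edge conG e).
  have w2 x' y' z' : edge G x' y' -> edge G y' z' ->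
    x' \in S -> y' \in S -> z' \in S ->
    exists2 n, walk G' n x' z' & n <= d x' z'.
    move=> e e' xS yS zS; have [->|nxz] := eqVneq x' z'; first exact: w0.
    exists 2; last exact: (even2 _ _ _ e e').
    by apply: (@walk_cat _ _ 1 1 _ y'); rewrite walk1 edgeG'.
  have w3 x' y' z' w' : edge G x' y' -> edge G y' z' -> edge G z' w' ->
    ~~ edge G x' w' ->
    x' \in S -> y' \in S -> z' \in S -> w' \in S ->
    exists2 n, walk G' n x' w' & n <= d x' w'.
    move=> e e' e'' ne xS yS zS wS.
    exists 3; last exact: (odd3 _ _ _ _ e e' e'').
    apply: (@walk_cat _ _ 1 2 _ y'); rewrite ?walk1 ?edgeG' //.
    by apply: (@walk_cat _ _ 1 1 _ z'); rewrite ?walk1 ?edgeG'.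
  have sy x' y' : x' \in S -> y' \in S ->
    (exists2 n, walk G' n x' y' & n <= d x' y') ->
    exists2 n, walk G' n y' x' & n <= d y' x'.
    by move=> xS yS [n w le]; exists n; [apply: walk_sym | rewrite (distC conG) ?SN].
  have c01 := w1 _ _ e01 S0 S1; have c12 := w1 _ _ e12 S1 S2.
  have c23 := w1 _ _ e23 S2 S3; have c34 := w1 _ _ e34 S3 S4.
  have c45 := w1 _ _ e45 S4 S5; have c50 := w1 _ _ e50 S5 S0.
  have c02 := w2 _ _ _ e01 e12 S0 S1 S2; have c13 := w2 _ _ _ e12 e23 S1 S2 S3.
  have c24 := w2 _ _ _ e23 e34 S2 S3 S4; have c35 := w2 _ _ _ e34 e45 S3 S4 S5.
  have c40 := w2 _ _ _ e45 e50 S4 S5 S0; have c51 := w2 _ _ _ e50 e01 S5 S0 S1.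
  have c03 := w3 _ _ _ _ e01 e12 e23 n03 S0 S1 S2 S3.
  have c14 := w3 _ _ _ _ e12 e23 e34 n14 S1 S2 S3 S4.
  have c25 := w3 _ _ _ _ e23 e34 e45 n25 S2 S3 S4 S5.
  rewrite !inE.
  by do 5?[case/orP]; move/eqP->; do 5?[case/orP]; move/eqP->;
     (apply: w0; assumption) || assumption || (apply: sy; assumption).
have isoG' : isometric_subgraph G' G.
  have distG' x y : x \in S -> y \in S -> dist G' x y = d x y.
    move=> xS yS; have [n wn le_n] := short x y xS yS.
    have le_G' := leq_trans (dist_min wn) le_n.
    apply/eqP; rewrite eqn_leq le_G' dist_min //.
    have: walk G' (dist G' x y) x y.
      apply: walk_dist; case/walkP: wn => p [pp <- _]; by apply/connectP; exists p.
    case/walkP=> p [pp lp sp]; apply/walkP; exists p; split=> //.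
    by apply: sub_path pp => u v /and3P[].
  split; first split.
  - by apply/set0Pn; exists a0; rewrite nodesG'.
  - rewrite nodesG' => x y xS yS; have [n /walkP[p [pp <- _]] _] := short x y xS yS.
    by apply/connectP; exists p.
  - by split; [rewrite nodesG'; apply/subsetP | move=> u v /and3P[]].
  - by rewrite nodesG'.
have [_ _ distG'] := isoG'.
have modG' : modular G' by case: frameG => _ _; apply.
rewrite nodesG' in distG'; rewrite -nodesG' in S0 S2 S4.
have [v] := modG' _ _ _ S0 S2 S4; rewrite nodesG' in S0 S2 S4 *.
move=> vS; rewrite /median !distG' //.
have d02 : d a0 a2 = 2 by apply: dist2 e01 e12 _ => //; apply: contraNneq n03 => ->.
have d24 : d a2 a4 = 2 by apply: dist2 e23 e34 _ => //; apply: contraNneq n25 => ->.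
have d04 : d a0 a4 = 2.
  rewrite (distC conG) //; apply: dist2 e45 e50 _ => //.
  by apply: contraNneq n14 => ->; rewrite edge_sym.
rewrite d02 d24 d04 (distC conG (SN _ vS) a2N).
case/and3P=> /eqP m1 /eqP m2 /eqP m3.
have [v0 v2 v4] : [/\ d a0 v = 1, d a2 v = 1 & d v a4 = 1].
  by move: m1 m2 m3; clear=> *; split; lia.
move/eqP: v0; move/eqP: v2; move/eqP: v4; rewrite !(dist1 conG) ?SN // => v4 v2 v0.
move: vS; rewrite !inE; do 5?[case/orP]; move/eqP=> eqv; subst v.
- by rewrite edge_irr in v0.
- by rewrite v4 in n14.
- by rewrite edge_irr in v2.
- by rewrite v0 in n03.
- by rewrite edge_irr in v4.
- by rewrite v2 in n25.
Qed.

(** The edges are those of [K_{3,3}] with parts [s, c, c'] and [y1, y2, e], except the one joining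
    [s] and [e]. Passing five times to the opposite edge of a 4-circuit leads from [c y2] back to
    the same edge reversed, which contradicts orientability. *)
Lemma frame_no_K33minus s c c' y1 y2 e :
    y1 != y2 -> c != c' -> s != c -> s != c' -> e != y1 -> e != y2 ->
    edge G s y1 -> edge G s y2 -> edge G c y1 -> edge G c y2 -> edge G c e ->
    edge G c' y1 -> edge G c' y2 -> edge G c' e -> False.
Proof.
move=> ny nc nsc nsc' ne1 ne2 s1 s2 c1 c2 ce c1' c2' ce'.
case: frameG => _ [o [_ oE] osq] _.
have {}osq a b u v : a != u -> b != v ->
    edge G a b -> edge G u b -> edge G u v -> edge G a v ->
  o a b = o v u /\ o b u = o a v.
  move=> nau nbv eab eub euv eav; apply: osq.
    rewrite /= !inE !negb_or nau nbv !andbT (edge_neq eab) (edge_neq eav) (edge_neq euv).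
    by rewrite eq_sym (edge_neq eub).
  by rewrite /= eab edge_sym eub euv edge_sym eav.
have n1e : y1 != e by rewrite eq_sym.
have n2e : y2 != e by rewrite eq_sym.
have [q1 _] := osq _ _ _ _ nc n1e c1 c1' ce' ce.
have [q3 _] := osq _ _ _ _ nc n2e c2 c2' ce' ce.
have [q5 _] := osq _ _ _ _ nsc ny s1 c1 c2 s2.
have [q7 _] := osq _ _ _ _ nsc' ny s1 c1' c2' s2.
have [q9 _] := osq _ _ _ _ nc ny c1 c1' c2' c2.
by have := oE _ _ c2; rewrite -q5 q7 -q9 q1 -q3 addbb.
Qed.

End Frame.

(** * Levels from a base node *)

(* [y] is below [s]: the lower node is the last argument. *)
Definition below (T : finType) (G : graph T) (p s y : T) : bool :=
  edge G s y && (dist G p y < dist G p s).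

(** For a node of a frame the default [s] is taken only if [s] is the base node, which is therefore
    fixed. *)
Definition descend (T : finType) (G : graph T) (p s : T) : T :=
  if #|below G p s| <= 1 then odflt s [pick y | below G p s y]
  else odflt s [pick c | [forall (y | below G p s y), below G p y c]].

Definition good (T : finType) (G : graph T) (p : T) (A : pred T) : Prop :=
  [/\ A p, forall s y, below G p s y -> A s -> A y
    & forall s y y', y != y' -> below G p s y -> below G p s y' -> A y -> A y' -> A s].

Variant recede_spec (T : finType) (G : graph T) (p s : T) : T -> Prop :=
  | RecedeBase of s = p : recede_spec G p s p
  | RecedeUnique y of below G p s y & (forall y', below G p s y' -> y' = y) :
      recede_spec G p s y
  | RecedeMeet c y y' of y != y' & below G p s y & below G p s y'
      & (forall x, below G p s x -> below G p x c) :
      recede_spec G p s c.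

Lemma goodI (T : finType) (G : graph T) (p : T) (A A' A'' : pred T) :
    good G p A -> good G p A' ->
    {in nodes G, forall x, A'' x = A x && A' x} -> p \in nodes G ->
  good G p A''.
Proof.
case=> [Ap dA mA] [Ap' dA' mA'] eA pN.
have N s y : below G p s y -> s \in nodes G /\ y \in nodes G.
  by case/andP=> e _; rewrite (edge_nodes e) (edge_nodesr e).
split=> [|s y sy|s y y' ny sy sy']; first by rewrite eA // Ap.
  have [sN yN] := N _ _ sy; rewrite !eA //.
  by case/andP=> /(dA _ _ sy) -> /(dA' _ _ sy).
have [[sN yN] [_ yN']] := (N _ _ sy, N _ _ sy'); rewrite !eA //.
case/andP=> a1 a2 /andP[a3 a4].
by rewrite (mA _ _ _ ny sy sy') // (mA' _ _ _ ny sy sy').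
Qed.

Section Levels.
Variables (T : finType) (G : graph T) (p : T).
Hypotheses (frameG : frame G) (pN : p \in nodes G).
Local Notation d := (dist G).
Local Notation N := (nodes G).
Local Notation low := (below G p).
Local Notation recede := (descend G p).
Local Notation good := (good G p).
Let conG := frame_connected frameG.
Let modG := frame_modular frameG.

Lemma low_edge s y : low s y -> edge G s y. Proof. by case/andP. Qed.

Lemma low_lt s y : low s y -> d p y < d p s. Proof. by case/andP. Qed.

Lemma low_level s y : low s y -> d p s = (d p y).+1.
Proof. by case/andP=> /(edge_level conG modG pN) [->|//]; rewrite ltnNge leqnSn. Qed.

Lemma low_base y : low p y = false.
Proof. by rewrite /below distxx ltn0 andbF. Qed.

Lemma edge_low x y : edge G x y -> low x y || low y x.
Proof.
move=> exy; rewrite /below exy edge_sym exy /=.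
by case: (edge_level conG modG pN exy) => ->; rewrite ltnSn ?orbT.
Qed.

Lemma low_exists s : s \in N -> s != p -> exists y, low s y.
Proof.
move=> sN nsp; have [y esy ds] := dist_step conG sN pN nsp.
exists y; rewrite /below esy (distC conG pN sN) ds /= ltnS.
by rewrite (distC conG pN (edge_nodesr esy)) leqnn.
Qed.

(** The median of [p], [y1], [y2] will do: [y1] and [y2] are on the same level and at distance 2, so
    it is adjacent to both and one level lower. *)
Lemma low_common s y1 y2 : y1 != y2 -> low s y1 -> low s y2 ->
  exists c, low y1 c /\ low y2 c.
Proof.
move=> ny l1 l2; have [e1 e2] := (low_edge l1, low_edge l2).
have [y1N y2N] := (edge_nodesr e1, edge_nodesr e2).
have d12 : d y1 y2 = 2 by apply: dist2 e2 ny => //; rewrite edge_sym.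
have [v vN /and3P[/eqP m1 /eqP m2 /eqP m3]] := modG pN y1N y2N.
have [h1 h2] := (low_level l1, low_level l2); rewrite (distC conG vN y1N) in m1.
rewrite (distC conG vN y2N) d12 in m2; rewrite (distC conG vN y2N) in m3.
have [k1 k2] : d y1 v = 1 /\ d y2 v = 1.
  by move: m1 m2 m3 h1 h2; clear=> *; lia.
exists v; rewrite /below -!(dist1 conG) // k1 k2.
by move: m1 m3 k1 k2; clear=> *; split; lia.
Qed.

(** Two such nodes [c], [c'] have in turn a common neighbour [e] below them, and the six nodes form
    the configuration of [frame_no_K33minus]. *)
Lemma low_common_unique s y1 y2 c c' : y1 != y2 -> low s y1 -> low s y2 ->
  low y1 c -> low y2 c -> low y1 c' -> low y2 c' -> c = c'.
Proof.
move=> ny s1 s2 c1 c2 c1' c2'; apply/eqP/negP=> /negP nc.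
have [e [ce ce']] := low_common nc c1 c1'.
have lv := low_level; have ne x y : d p x <> d p y -> x != y.
  by move=> dxy; apply/eqP=> eq_xy; rewrite eq_xy in dxy.
have := And5 (lv _ _ s1) (lv _ _ s2) (lv _ _ c1) (lv _ _ c1') (lv _ _ ce).
have ed x y : low x y -> edge G y x by rewrite edge_sym => /low_edge.
case=> d1 d2 d3 d4 d5.
apply: (frame_no_K33minus frameG ny nc _ _ _ _ (low_edge s1) (low_edge s2)
         (ed _ _ c1) (ed _ _ c2) (low_edge ce) (ed _ _ c1') (ed _ _ c2')
         (low_edge ce'));
  by apply: ne; move: d1 d2 d3 d4 d5; clear=> *; lia.
Qed.

(** Otherwise choose [b] below [y1], [y3] and [a] below [y2], [y3]. In the hexagon [y1 c y2 a y3 b]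
    a diagonal at [y1] or [y2] identifies [c] with [a] or [b] by uniqueness, and the third one joins
    [c] to [y3]. *)
Lemma low_common_all s y1 y2 y3 c : y1 != y2 -> low s y1 -> low s y2 ->
  low y1 c -> low y2 c -> low s y3 -> low y3 c.
Proof.
move=> n12 s1 s2 c1 c2 s3; apply/negPn/negP=> nc3.
have n13 : y1 != y3 by apply: contraNneq nc3 => <-.
have n23 : y2 != y3 by apply: contraNneq nc3 => <-.
have [b [b1 b3]] := low_common n13 s1 s3; have [a [a2 a3]] := low_common n23 s2 s3.
have ed x y : low x y -> edge G y x by rewrite edge_sym => /low_edge.
have lvl y x : low s y -> d p x < d p s -> edge G y x -> low y x.
  move=> /low_level dy dx eyx; case/orP: (edge_low eyx) => // /low_level.
  by move: dy dx; clear=> *; lia.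
have lt x y : low s y -> low y x -> d p x < d p s.
  by move=> sy yx; apply: ltn_trans (low_lt yx) (low_lt sy).
have := frame_no_hexagon frameG (low_edge c1) (ed _ _ c2) (low_edge a2) (ed _ _ a3)
  (low_edge b3) (ed _ _ b1).
case/or3P=> [e|e|e].
- have a1 := lvl _ _ s1 (lt _ _ s2 a2) e.
  by move: nc3; rewrite (low_common_unique n12 s1 s2 c1 c2 a1 a2) a3.
- by case/negP: nc3; apply: lvl s3 (lt _ _ s1 c1) _; rewrite edge_sym.
- have b2 := lvl _ _ s2 (lt _ _ s1 b1) e.
  by move: nc3; rewrite (low_common_unique n12 s1 s2 c1 c2 b1 b2) b3.
Qed.

Lemma recedeP s : s \in N -> recede_spec G p s (recede s).
Proof.
move=> sN; rewrite /descend; case: leqP => [le1|].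
  have [eq_sp|nsp] := eqVneq s p.
    case: pickP => [y|_] /=; last by rewrite {2}eq_sp; constructor.
    by rewrite eq_sp low_base.
  case: pickP => [y sy|no]; last by have [y] := low_exists sN nsp; rewrite no.
  apply: RecedeUnique => // y' sy'; have/card_le1_eqP := le1; exact.
case/card_gt1P=> y [y' [sy sy' ny]]; have [c [yc yc']] := low_common ny sy sy'.
case: pickP => [c' /forall_inP c'P|/(_ c)/negP[]].
  exact: RecedeMeet ny sy sy' c'P.
by apply/forall_inP=> x sx; apply: low_common_all ny sy sy' yc yc' sx.
Qed.

Lemma recede_nodes s : s \in N -> recede s \in N.
Proof.
move=> sN; case: recedeP => // [y sy _|c y y' _ sy _ cP].
  exact: edge_nodesr (low_edge sy).
exact: edge_nodesr (low_edge (cP _ sy)).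
Qed.

Lemma recede_level s : s \in N -> s != p -> d p (recede s) < d p s.
Proof.
move=> sN; case: recedeP => // [->|y sy _ _|c y y' _ sy _ cP _]; first by rewrite eqxx.
  exact: low_lt.
exact: ltn_trans (low_lt (cP _ sy)) (low_lt sy).
Qed.

Lemma good_recede_le A s : good A -> s \in N -> A s -> A (recede s).
Proof.
case=> _ dA _ sN As; case: recedeP => // [<- //|y sy _|c y y' _ sy _ cP].
  exact: dA sy As.
exact: dA (cP _ sy) (dA _ _ sy As).
Qed.

(** If [s] has several neighbours below it, [descend] sends each of them to [c = descend s] or to a
    node below [c]. This settles down-closedness. For the last clause, if neither of two lower
    neighbours is sent to [c], their images are distinct neighbours below [c], so that [A c]
    follows. *)
Lemma good_recede A : good A -> good (fun s => A (recede s)).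
Proof.
move=> gA; have [Ap dA mA] := gA.
have lowN s y : low s y -> y \in N by move/low_edge/edge_nodesr.
have lowN' s y : low s y -> s \in N by move/low_edge/edge_nodes.
split=> [|s y sy|s y y' ny sy sy'].
- by case: (recedeP pN) => // [y|c y y' _]; rewrite low_base.
- case: (recedeP (lowN' _ _ sy)) => [eq_sp|y1 _ y1P|c y1 y2 _ _ _ cP] Ax.
  + by rewrite eq_sp low_base in sy.
  + by rewrite -(y1P _ sy) in Ax; apply: good_recede_le => //; apply: lowN sy.
  have yc := cP _ sy; case: (recedeP (lowN _ _ sy)) => [eq_yp|y3 _ y3P|b z z' _ _ _ bP].
  + by rewrite eq_yp low_base in yc.
  + by rewrite -(y3P _ yc).
  + by apply: dA (bP _ yc) Ax.
case: (recedeP (lowN' _ _ sy)) => [eq_sp|y1 _ y1P|c y1 y2 _ _ _ cP].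
- by rewrite eq_sp low_base in sy.
- by rewrite (y1P _ sy) (y1P _ sy') eqxx in ny.
have [yc yc'] := (cP _ sy, cP _ sy').
case: (recedeP (lowN _ _ sy)) => [eq_yp|b _ bP|e x1 x2 nx yx1 yx2 eP].
- by rewrite eq_yp low_base in yc.
- by rewrite (bP _ yc).
case: (recedeP (lowN _ _ sy')) => [eq_yp|b _ bP|e' x1' x2' nx' yx1' yx2' eP'].
- by rewrite eq_yp low_base in yc'.
- by rewrite (bP _ yc').
(* If the images agree, nodes [x] and [x'] other than [c] complete a hexagon [y x e x' y' s]. Two of
   its diagonals contradict the uniqueness of [c], and the third would join levels three apart. *)
have [eq_e|ne] := eqVneq e e'; last exact: mA ne (eP _ yc) (eP' _ yc').
have [x nxc yx] : exists2 x, x != c & low y x.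
  by have [eq1|] := eqVneq x1 c; [exists x2; rewrite -?eq1 // eq_sym | exists x1].
have [x' nxc' yx'] : exists2 x, x != c & low y' x.
  by have [eq1|] := eqVneq x1' c; [exists x2'; rewrite -?eq1 // eq_sym | exists x1'].
have ed a b : low a b -> edge G b a by rewrite edge_sym => /low_edge.
have xe' : low x' e by rewrite eq_e; apply: eP'.
have := frame_no_hexagon frameG (low_edge yx) (low_edge (eP _ yx)) (ed _ _ xe')
  (ed _ _ yx') (ed _ _ sy') (low_edge sy).
have lvl a b : d p b < d p a -> edge G a b -> low a b by rewrite /below => -> ->.
have [l1 l2 l3 l4] := And4 (low_level sy) (low_level sy') (low_level yx) (low_level yx').
have l5 := low_level xe'.
case/or3P=> [e1|e1|e1].
- have z : low y x' by apply: lvl => //; move: l1 l2 l3 l4; clear=> *; lia.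
  by rewrite (low_common_unique ny sy sy' z yx' yc yc') eqxx in nxc'.
- have z : low y' x.
    by apply: lvl; rewrite 1?edge_sym //; move: l1 l2 l3 l4; clear=> *; lia.
  by rewrite (low_common_unique ny sy sy' yx z yc yc') eqxx in nxc.
- case: (edge_level conG modG pN e1); move: l1 l2 l3 l4 l5; clear=> *; lia.
Qed.

End Levels.

(** * Closed relations between two frames *)

Section FoldDef.
Variables (T1 T2 : finType) (G1 : graph T1) (G2 : graph T2) (p1 : T1) (p2 : T2).
Implicit Types (B : T1 -> T2 -> bool) (s : T1) (t : T2).

Definition closed_rel B : Prop :=
  [/\ forall s t, B s t -> s \in nodes G1 /\ t \in nodes G2,
      {in nodes G1, forall s, good G2 p2 (B s)}
    & {in nodes G2, forall t, good G1 p1 (B^~ t)}].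

Definition thicken B s t : bool :=
  [&& s \in nodes G1, t \in nodes G2, B s (descend G2 p2 t) & B (descend G1 p1 s) t].

Definition some_low (T : finType) (G : graph T) (p s : T) : T :=
  odflt s [pick y | below G p s y].

(* A coordinate moves to the neighbour below it in [B], if there is one, and
   otherwise by two steps, or by one step if the other coordinate moves by one step
   only.  In the last case every neighbour below would do, but adjacent pairs must
   make the same choice, whence [some_low]. *)
Definition fold_onto B (x : T1 * T2) : T1 * T2 :=
  let: (s, t) := x in
  if B s t then x else
  match [pick y | below G1 p1 s y && B y t], [pick z | below G2 p2 t z && B s z] with
  | Some y, Some z => (y, z)
  | Some y, None => (y, some_low G2 p2 t)
  | None, Some z => (some_low G1 p1 s, z)
  | None, None => (descend G1 p1 s, descend G2 p2 t)
  end.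

Definition adj2 (u v : T1 * T2) : bool :=
  (edge G1 u.1 v.1 && (u.2 == v.2)) || ((u.1 == v.1) && edge G2 u.2 v.2).

Lemma adj2C u v : adj2 u v = adj2 v u.
Proof.
by rewrite /adj2 edge_sym [u.2 == _]eq_sym [u.1 == _]eq_sym [edge G2 _ _]edge_sym.
Qed.

End FoldDef.

(** This symmetry reduces moves in the second factor to moves in the first. *)
Lemma fold_swap (T1 T2 : finType) (G1 : graph T1) (G2 : graph T2) p1 p2 B s t :
  fold_onto G2 G1 p2 p1 (fun t s => B s t) (t, s) =
  let: (s', t') := fold_onto G1 G2 p1 p2 B (s, t) in (t', s').
Proof. by rewrite /fold_onto; case: ifP => // _; do 2!case: pickP. Qed.

Section Fold.
Variables (T1 T2 : finType) (G1 : graph T1) (G2 : graph T2) (p1 : T1) (p2 : T2).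
Hypotheses (frame1 : frame G1) (frame2 : frame G2).
Hypotheses (p1N : p1 \in nodes G1) (p2N : p2 \in nodes G2).
Variable B : T1 -> T2 -> bool.
Hypothesis closedB : closed_rel G1 G2 p1 p2 B.
Local Notation low1 := (below G1 p1).
Local Notation low2 := (below G2 p2).
Local Notation recede1 := (descend G1 p1).
Local Notation recede2 := (descend G2 p2).
Local Notation thick := (thicken G1 G2 p1 p2 B).
Local Notation fold := (fold_onto G1 G2 p1 p2 B).
Local Notation adj := (adj2 G1 G2).

Lemma closed_swap : closed_rel G2 G1 p2 p1 (fun t s => B s t).
Proof. by case: closedB => BN col row; split=> // t s /BN[]. Qed.

Lemma closed_row s y t : low1 s y -> B s t -> B y t.
Proof.
case: closedB => BN _ row sy Bst; have [_ tN] := BN _ _ Bst.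
by have [_ + _] := row t tN; apply; first exact: sy.
Qed.

Lemma closed_col s t z : low2 t z -> B s t -> B s z.
Proof.
case: closedB => BN col _ tz Bst; have [sN _] := BN _ _ Bst.
by have [_ + _] := col s sN; apply; first exact: tz.
Qed.

Lemma closed_row2 s y y' t : y != y' -> low1 s y -> low1 s y' ->
  B y t -> B y' t -> B s t.
Proof.
case: closedB => BN _ row ny sy sy' By; have [_ tN] := BN _ _ By.
by have [_ _ +] := row t tN => /(_ s y y' ny sy sy' By).
Qed.

Lemma closed_base1 t : t \in nodes G2 -> B p1 t.
Proof. by case: closedB => _ _ row /row[]. Qed.

Lemma closed_base2 s : s \in nodes G1 -> B s p2.
Proof. by case: closedB => _ col _ /col[]. Qed.

(** Two such neighbours would put [s] itself into the row, so the choice is forced. *)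
Lemma pick_row s y t : ~~ B s t -> low1 s y -> B y t ->
  [pick y' | low1 s y' && B y' t] = Some y.
Proof.
move=> nB sy By; case: pickP => [y' /andP[sy' By']|/(_ y)]; last by rewrite sy By.
by have [->//|ny] := eqVneq y' y; rewrite (closed_row2 ny sy' sy) in nB.
Qed.

Lemma some_lowP s : s \in nodes G1 -> s != p1 -> low1 s (some_low G1 p1 s).
Proof.
move=> sN nsp; rewrite /some_low; case: pickP => //= no.
by have [y] := low_exists frame1 p1N sN nsp; rewrite no.
Qed.

Lemma thick_nodes s t : thick s t -> s \in nodes G1 /\ t \in nodes G2.
Proof. by case/and4P. Qed.

Lemma thick_neq s t : thick s t -> ~~ B s t -> s != p1 /\ t != p2.
Proof.
move=> /thick_nodes[sN tN] nB.
by split; apply: contraNneq nB => ->; rewrite (closed_base1, closed_base2).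
Qed.

(** Since [B (recede1 s) t] holds and [B y t] fails, [y] is not the value of [descend] at [s]; this
    leaves only the case of several lower neighbours. *)
Lemma low_thick s y t : low1 s y -> thick s t -> y \in nodes G1 ->
  ~~ B y t -> (forall z, low1 s z -> low1 z (recede1 s)) /\ B (recede1 s) t.
Proof.
move=> sy /and4P[sN _ _].
case: (recedeP frame1 p1N sN) => [eq_sp|x _ xP|c _ _ _ _ _ cP] Bst yN nB //.
- by rewrite eq_sp low_base in sy.
- by rewrite (xP _ sy) Bst in nB.
Qed.

Lemma no_row s t : thick s t -> ~~ B s t ->
    (forall y, low1 s y -> ~~ B y t) ->
  (forall y, low1 s y -> low1 y (recede1 s)) /\ B (recede1 s) t.
Proof.
move=> tst nB no; have [sN _] := thick_nodes tst; have [nsp _] := thick_neq tst nB.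
have [y sy] := low_exists frame1 p1N sN nsp.
exact: low_thick sy tst (edge_nodesr (low_edge sy)) (no _ sy).
Qed.

End Fold.

(** * The folding map lands in the relation and preserves adjacency *)

Section FoldStep.
Variables (T1 T2 : finType) (G1 : graph T1) (G2 : graph T2) (p1 : T1) (p2 : T2).
Hypotheses (frame1 : frame G1) (frame2 : frame G2).
Hypotheses (p1N : p1 \in nodes G1) (p2N : p2 \in nodes G2).
Variable B : T1 -> T2 -> bool.
Hypothesis closedB : closed_rel G1 G2 p1 p2 B.
Local Notation low1 := (below G1 p1).
Local Notation low2 := (below G2 p2).
Local Notation recede1 := (descend G1 p1).
Local Notation recede2 := (descend G2 p2).
Local Notation thick := (thicken G1 G2 p1 p2 B).
Local Notation fold := (fold_onto G1 G2 p1 p2 B).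
Local Notation adj := (adj2 G1 G2).
Let closedBt := closed_swap closedB.

Lemma thick_swap s t : thicken G2 G1 p2 p1 (fun t s => B s t) t s = thick s t.
Proof. by rewrite /thicken andbCA; do 2!congr (_ && _); rewrite andbC. Qed.

Lemma fold_id s t : B s t -> fold (s, t) = (s, t).
Proof. by rewrite /fold_onto => ->. Qed.

Lemma fold_mem s t : thick s t -> B (fold (s, t)).1 (fold (s, t)).2.
Proof.
move=> tst; rewrite /fold_onto; have [//|nB] := boolP (B s t).
have [sN tN] := thick_nodes tst; have [nsp ntp] := thick_neq closedB tst nB.
case: pickP => [y /andP[sy By]|noy]; case: pickP => [z /andP[tz Bz]|noz] /=.
- exact: (closed_col closedB tz By).
- exact: (closed_col closedB (some_lowP frame2 p2N tN ntp) By).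
- exact: (closed_row closedB (some_lowP frame1 p1N sN nsp) Bz).
have noy' y : low1 s y -> ~~ B y t by move=> sy; have := noy y; rewrite sy => /= ->.
have noz' z : low2 t z -> ~~ B s z by move=> tz; have := noz z; rewrite tz => /= ->.
have [_ Bpi] := no_row frame1 p1N closedB tst nB noy'.
have tst' : thicken G2 G1 p2 p1 (fun t s => B s t) t s by rewrite thick_swap.
have [zP _] := no_row frame2 p2N closedBt tst' nB noz'.
have tz := some_lowP frame2 p2N tN ntp.
(* The second coordinate moves down two steps inside the column of [recede1 s]. *)
exact: (closed_col closedB (zP _ tz) (closed_col closedB tz Bpi)).
Qed.

Lemma fold_low s y t : low1 s y -> thick s t -> thick y t ->
  adj (fold (s, t)) (fold (y, t)).
Proof.
move=> sy tst tyt; have [sN tN] := thick_nodes tst; have [yN _] := thick_nodes tyt.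
have [Bst|nB] := boolP (B s t).
  have Byt := closed_row closedB sy Bst.
  by rewrite !fold_id // /adj2 /= (low_edge sy) eqxx.
have [nsp ntp] := thick_neq closedB tst nB.
have tz := some_lowP frame2 p2N tN ntp; set z0 := some_low G2 p2 t in tz.
have [Byt|nBy] := boolP (B y t).
  (* The first coordinate of the image of [(s, t)] is forced to be [y], so the two images differ by
     one step in the second coordinate only. *)
  rewrite (fold_id Byt) /fold_onto (negPf nB) (pick_row closedB nB sy Byt).
  rewrite /adj2 [edge G2 _ _]edge_sym; case: pickP => [z /andP[tz' _]|_] /=.
    by rewrite eqxx (low_edge tz') orbT.
  by rewrite eqxx (low_edge tz) orbT.
(* The node [c] lies below all lower neighbours of [s], and it is the forced first coordinate of the
   image of [(y, t)]. *)
have [cP Bct] := low_thick frame1 p1N sy tst yN nBy; set c := recede1 s in cP Bct.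
rewrite /fold_onto (negPf nB) (negPf nBy) (pick_row closedB nBy (cP _ sy) Bct).
have tzB := pick_row closedBt.
case: (pickP (fun z => low2 t z && B s z)) => [z /andP[tz' Bsz]|noz].
  (* Both images have second coordinate [z]; their first coordinates are a lower neighbour of [s]
     and [c]. *)
  have Byz := closed_row closedB sy Bsz.
  rewrite (tzB _ _ _ nBy tz' Byz); case: pickP => [x /andP[sx _]|_] /=.
    by rewrite /adj2 /= (low_edge (cP _ sx)) eqxx.
  by rewrite /adj2 /= (low_edge (cP _ (some_lowP frame1 p1N sN nsp))) eqxx.
have noz' z : low2 t z -> ~~ B s z by move=> tz'; have := noz z; rewrite tz' => /= ->.
have tst' : thicken G2 G1 p2 p1 (fun t s => B s t) t s by rewrite thick_swap.
have [zP _] := no_row frame2 p2N closedBt tst' nB noz'.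
(* Without [x] both first coordinates are [c]; the second ones are [recede2 t] and a neighbour below
   [t]. *)
case: pickP => [x /andP[sx Bxt]|_] /=; last first.
  rewrite /adj2 [edge G2 _ _]edge_sym; case: pickP => [z /andP[tz' _]|_] /=.
    by rewrite eqxx (low_edge (zP _ tz')) orbT.
  by rewrite eqxx (low_edge (zP _ tz)) orbT.
(* Such a [z] is impossible: [B x z] and [B y z] with [x != y] would give [B s z]. *)
case: pickP => [z /andP[tz' Byz]|_] /=.
  have nxy : x != y by apply: contraNneq nBy => <-.
  have Bxz := closed_col closedB tz' Bxt.
  by case/negP: (noz' _ tz'); apply: (closed_row2 closedB nxy sx sy).
(* Both second coordinates are now the same [some_low G2 p2 t]. *)
by rewrite /adj2 /= (low_edge (cP _ sx)) eqxx.
Qed.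

Lemma fold_edge1 s y t : edge G1 s y -> thick s t -> thick y t ->
  adj (fold (s, t)) (fold (y, t)).
Proof.
move=> /(edge_low frame1 p1N) /orP[sy|ys] ts ty; first exact: fold_low.
by rewrite adj2C; apply: fold_low.
Qed.

(** Each row or column of [thick] is, on nodes, the intersection of one of [B] with the preimage of
    another under [descend]. *)
Lemma closed_thick : closed_rel G1 G2 p1 p2 thick.
Proof.
have [BN col row] := closedB.
split=> [s t /and4P[] //|s sN|t tN].
  have g1 := good_recede frame2 p2N (col _ sN).
  have g2 := col _ (recede_nodes frame1 p1N sN).
  by apply: goodI g1 g2 _ p2N => t tN; rewrite /thicken sN tN.
have g1 := good_recede frame1 p1N (row _ tN).
have g2 := row _ (recede_nodes frame2 p2N tN).
by apply: goodI g2 g1 _ p1N => s sN; rewrite /thicken sN tN.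
Qed.

Lemma sub_thick s t : B s t -> thick s t.
Proof.
move=> Bst; have [BN col row] := closedB; have [sN tN] := BN _ _ Bst.
rewrite /thicken sN tN (good_recede_le frame2 p2N (col _ sN)) //=.
exact: (good_recede_le frame1 p1N (row _ tN)).
Qed.

End FoldStep.

Section FoldEdge2.
Variables (T1 T2 : finType) (G1 : graph T1) (G2 : graph T2) (p1 : T1) (p2 : T2).
Hypotheses (frame1 : frame G1) (frame2 : frame G2).
Hypotheses (p1N : p1 \in nodes G1) (p2N : p2 \in nodes G2).
Variable B : T1 -> T2 -> bool.
Hypothesis closedB : closed_rel G1 G2 p1 p2 B.
Local Notation thick := (thicken G1 G2 p1 p2 B).
Local Notation fold := (fold_onto G1 G2 p1 p2 B).

Lemma fold_edge2 s t z : edge G2 t z -> thick s t -> thick s z ->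
  adj2 G1 G2 (fold (s, t)) (fold (s, z)).
Proof.
move=> tz st sz; rewrite -thick_swap in st; rewrite -thick_swap in sz.
have := fold_edge1 frame2 frame1 p2N p1N (closed_swap closedB) tz st sz.
rewrite (fold_swap G1 G2 p1 p2 B s t) (fold_swap G1 G2 p1 p2 B s z).
case: (fold (s, t)) (fold (s, z)) => [s1 t1] [s2 t2].
by rewrite /adj2 /= orbC andbC [_ && (s1 == s2)]andbC.
Qed.

End FoldEdge2.

(** * The metric of a Cartesian product *)

Section Product.
Variables (k : nat) (T : 'I_k -> finType) (H : forall i, graph (T i)).
Hypothesis conH : forall i, connected_graph (H i).
Local Notation point := {dffun forall i : 'I_k, T i}.
Local Notation K := (cartesian_product H).
Implicit Types x y z v : point.

Definition subst x (i : 'I_k) (u : T i) : point := [ffun j => dfwith x u j].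

Lemma subst_in x i (u : T i) : subst x u i = u.
Proof. by rewrite ffunE dfwith_in. Qed.

Lemma subst_out x i (u : T i) j : j != i -> subst x u j = x j.
Proof. by rewrite eq_sym => nij; rewrite ffunE dfwith_out. Qed.

Lemma subst_id x i (u : T i) : u = x i -> subst x u = x.
Proof.
move=> ->; apply/ffunP=> j; have [->|nij] := eqVneq j i; first by rewrite subst_in.
by rewrite subst_out.
Qed.

Lemma prod_nodesP x : reflect (forall i, x i \in nodes (H i)) (x \in nodes K).
Proof. exact: setXnP. Qed.

Lemma prod_edgeP x y :
  reflect [/\ x \in nodes K, y \in nodes K
            & exists2 i, edge (H i) (x i) (y i) & forall j, j != i -> x j = y j]
          (edge K x y).
Proof.
apply: (iffP and3P) => [[xN yN /existsP[i /andP[e /forall_inP a]]]|[xN yN [i e a]]].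
  by split=> //; exists i => // j /a/eqP.
by split=> //; apply/existsP; exists i; rewrite e; apply/forall_inP=> j /a ->.
Qed.

Definition pdist x y := \sum_i dist (H i) (x i) (y i).

Lemma pdist_subst x y i (u : T i) c :
  (dist (H i) u (y i) + c = dist (H i) (x i) (y i))%N ->
  pdist (subst x u) y + c = pdist x y.
Proof.
move=> eq_c; rewrite /pdist (bigD1 i) //= [RHS](bigD1 i) //= subst_in.
rewrite addnAC eq_c; congr (_ + _); apply: eq_bigr => j nij.
by rewrite subst_out.
Qed.

Lemma subst_nodes x i (u : T i) :
  x \in nodes K -> u \in nodes (H i) -> subst x u \in nodes K.
Proof.
move=> /prod_nodesP xN uN; apply/prod_nodesP=> j.
by have [->|nij] := eqVneq j i; rewrite ?subst_in ?subst_out.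
Qed.

Lemma subst_edge x i (u : T i) :
  x \in nodes K -> edge (H i) (x i) u -> edge K x (subst x u).
Proof.
move=> xN e; apply/prod_edgeP; split=> //.
  exact: subst_nodes (edge_nodesr e).
by exists i => [|j nji]; rewrite ?subst_in ?subst_out.
Qed.

Lemma pdist_walk x y : x \in nodes K -> y \in nodes K -> walk K (pdist x y) x y.
Proof.
move=> xN yN; move: {2}(pdist x y) (erefl (pdist x y)) => n.
have yNi i := prod_nodesP _ yN i.
elim: n x xN => [|n IHn] x xN dxy; have xNi i := prod_nodesP _ xN i.
  rewrite dxy; apply/walkP; exists [::]; split=> //=; apply/ffunP=> i.
  apply: (dist_eq0 (conH i)) => //; apply/eqP; move/eqP: dxy.
  by rewrite /pdist sum_nat_eq0 => /forallP/(_ i).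
have [i nxy] : exists i, x i != y i.
  apply/existsP; apply: contra_eqT dxy; rewrite negb_exists => /forallP eq_xy.
  rewrite /pdist big1 // => i _; move: (eq_xy i); rewrite negbK => /eqP ->.
  exact: distxx.
have [u e du] := dist_step (conH i) (xNi i) (yNi i) nxy.
have xuN : subst x u \in nodes K by apply: subst_nodes (edge_nodesr e).
have := @pdist_subst x y i u 1; rewrite du !addn1 => /(_ erefl) dxu.
rewrite -dxu -add1n; apply: (walk_cat (y := subst x u)).
  by rewrite walk1 subst_edge.
by apply: IHn => //; apply: succn_inj; rewrite dxu.
Qed.

Lemma prod_connect x y : x \in nodes K -> y \in nodes K -> connect (edge K) x y.
Proof.
move=> xN yN; case/walkP: (pdist_walk xN yN) => p [pp <- _].
by apply/connectP; exists p.
Qed.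

Lemma pdist_triangle x y z : x \in nodes K -> y \in nodes K -> z \in nodes K ->
  pdist x z <= pdist x y + pdist y z.
Proof.
move=> /prod_nodesP xN /prod_nodesP yN /prod_nodesP zN.
by rewrite /pdist -big_split leq_sum // => i _; apply: dist_triangle.
Qed.

Lemma pdist_edge x y : edge K x y -> pdist x y = 1.
Proof.
case/prod_edgeP=> xN yN [i e a]; rewrite /pdist (bigD1 i) //= big1 => [|j /a ->].
  by rewrite (dist_edge (conH i) e).
exact: distxx.
Qed.

Lemma dist_prod x y : x \in nodes K -> y \in nodes K -> dist K x y = pdist x y.
Proof.
move=> xN yN; apply/eqP; rewrite eqn_leq dist_min ?pdist_walk //=.
have /walkP[p [pp <- <-]] := walk_dist (prod_connect xN yN).
elim: p x xN pp => [|z p IHp] x xN.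
  by move=> _; rewrite /pdist big1 // => i _; apply: distxx.
have path_cons : path (edge K) x (z :: p) = edge K x z && path (edge K) z p by [].
rewrite path_cons => /andP[e pp]; have zN := edge_nodesr e.
change (pdist x (last z p) <= (size p).+1).
have lN : last z p \in nodes K.
  by case: (lastP p) pp => // q w; rewrite rcons_path last_rcons => /andP[_ /edge_nodesr].
apply: leq_trans (pdist_triangle xN zN lN) _.
by rewrite (pdist_edge e) add1n ltnS IHp.
Qed.

(** The triangle inequalities of the factors add up to an equality, so each of them is one. *)
Lemma sum_between x y v : x \in nodes K -> y \in nodes K -> v \in nodes K ->
    pdist x v + pdist v y <= pdist x y ->
  forall i, dist (H i) (x i) (v i) + dist (H i) (v i) (y i) = dist (H i) (x i) (y i).
Proof.
move=> xN yN vN le_xy i; apply/esym/eqP; move: i.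
have tri i : dist (H i) (x i) (y i) <= dist (H i) (x i) (v i) + dist (H i) (v i) (y i)
   ?= iff (dist (H i) (x i) (y i) == dist (H i) (x i) (v i) + dist (H i) (v i) (y i)).
  by split=> //; apply: dist_triangle => //; apply/prod_nodesP.
have := leqif_sum (fun i (_ : true) => tri i); rewrite big_split /=.
by case=> le_yx; rewrite eqn_leq le_yx le_xy => /esym/forallP.
Qed.

(** Medians are taken in the factors, so that the notion applies to a bare node set, such as the
    image of a map, without a metric of its own. *)
Definition median_closed (M : {set point}) : Prop :=
  forall x y z, x \in M -> y \in M -> z \in M ->
  exists2 m, m \in M & forall i, median (H i) (x i) (y i) (z i) (m i).

Lemma isometric_median_closed K' :
  isometric_subgraph K' K -> modular K' -> median_closed (nodes K').
Proof.
case=> _ [/subsetP sK _] dK modK x y z xN yN zN.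
have [m mN med] := modK x y z xN yN zN; exists m => // i.
move: med; rewrite /median !dK // !dist_prod ?sK //.
case/and3P=> /eqP m1 /eqP m2 /eqP m3.
by rewrite !sum_between ?sK ?m1 ?m2 ?m3 ?eqxx.
Qed.

End Product.

(** * Retractions of a product of frames *)

Lemma between_self (T : finType) (G : graph T) x v :
  connected_graph G -> x \in nodes G -> v \in nodes G ->
  dist G x v + dist G v x = dist G x x -> v = x.
Proof.
move=> conG xN vN; rewrite distxx => /eqP; rewrite addn_eq0 => /andP[/eqP d0 _].
by rewrite (dist_eq0 conG xN vN d0).
Qed.

(** By the pigeonhole principle two iterates coincide, so the iterates are periodic from some index
    [a] on. *)
Lemma iter_idempotent (T : finType) (h : T -> T) :
  exists n, forall x, iter n.+1 h (iter n.+1 h x) = iter n.+1 h x.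
Proof.
pose F (n : 'I_(#|{ffun T -> T}|.+1)) := [ffun x => iter n h x].
have [a [b [lt_ab eqF]]] : exists a b, a < b /\ forall x, iter a h x = iter b h x.
  have /injectivePn[a [b nab /ffunP eqF]] : ~~ injectiveb F.
    by apply/injectiveP=> /leq_card; rewrite card_ord ltnn.
  have {}eqF x : iter a h x = iter b h x by have := eqF x; rewrite !ffunE.
  case: (ltngtP a b) => [lt|lt|/val_inj/eqP]; last by rewrite (negPf nab).
    by exists a, b.
  by exists b, a; split=> // x; rewrite eqF.
pose c := b - a; have c_gt0 : 0 < c by rewrite subn_gt0.
have per n x : a <= n -> iter (n + c) h x = iter n h x.
  move=> le_an; rewrite -(subnK le_an) -addnA !iterD; congr (iter _ h _).
  by rewrite -iterD subnKC ?eqF // ltnW.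
have perM m n x : a <= n -> iter (n + m * c) h x = iter n h x.
  move=> le_an; elim: m => [|m IHm]; first by rewrite addn0.
  by rewrite mulSn addnCA addnC per ?IHm // (leq_trans le_an) ?leq_addr.
have N_gt0 : 0 < a.+1 * c by rewrite muln_gt0.
(* A positive multiple of the period [c] that is at least [a]. *)
exists (a.+1 * c).-1 => x; rewrite prednK // -iterD perM //.
by rewrite (leq_trans (leqnSn a)) // leq_pmulr.
Qed.

Section Retract.
Variables (k : nat) (T : 'I_k -> finType) (H : forall i, graph (T i)).
Variable (K' : graph {dffun forall i : 'I_k, T i}).
Hypothesis frame_H : forall i, frame (H i).
Local Notation point := {dffun forall i : 'I_k, T i}.
Local Notation K := (cartesian_product H).
Hypotheses (isometric_K' : isometric_subgraph K' K) (modular_K' : modular K').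
Variable a : 'I_k -> point.
Hypothesis aK : forall i, a i \in nodes K'.
Hypothesis a_layer : forall i u, u \in nodes (H i) -> subst (a i) u \in nodes K'.
Implicit Types (x y z v w : point) (i j l : 'I_k) (M : {set point}).
Let conH i := frame_connected (frame_H i).

Lemma sub_nodes x : x \in nodes K' -> x \in nodes K.
Proof. by case: isometric_K' => _ [/subsetP sK _] _ /sK. Qed.

Lemma nodeK x i : x \in nodes K -> x i \in nodes (H i).
Proof. by move/prod_nodesP. Qed.

Definition projection M i j (s : T i) (t : T j) : bool :=
  [exists x in M, (x i == s) && (x j == t)].

Lemma projectionP M i j (s : T i) (t : T j) :
  reflect (exists x, [/\ x \in M, x i = s & x j = t]) (projection M s t).
Proof.
apply: (iffP exists_inP) => [[x xM /andP[/eqP xi /eqP xj]]|[x [xM xi xj]]].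
  by exists x.
by exists x; rewrite // xi xj !eqxx.
Qed.

(** * Projections of median-closed sets to two factors *)

Section Projections.
Variable M : {set point}.
Hypotheses (closedM : median_closed H M).
Hypotheses (K'M : nodes K' \subset M) (MK : M \subset nodes K).

(** The full [j]-layer through [a j] yields all pairs [(a j i, t)]. If two nodes of [M] lie over [t]
    and [s] is between their [i]-coordinates, their median with a node over [s], taken from the full
    [i]-layer, lies over [(s, t)]. Both clauses follow: a lower neighbour of [s] is between [s] and
    the base, and [s] is between two of its neighbours. *)
Lemma projection_good i j (t : T j) : i != j -> t \in nodes (H j) ->
  good (H i) (a j i) (fun s => projection M s t).
Proof.
move=> nij tN; set p := a j i.
have inK x : x \in M -> x \in nodes K by apply/subsetP.
have K'inM x : x \in nodes K' -> x \in M by apply/subsetP.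
have pN : p \in nodes (H i) by apply/nodeK/sub_nodes.
have full_i s : s \in nodes (H i) -> exists2 w, w \in M & w i = s.
  by move=> sN; exists (subst (a i) s); rewrite ?subst_in // K'inM ?a_layer.
have full_j : exists2 w, w \in M & w i = p /\ w j = t.
  by exists (subst (a j) t); rewrite ?subst_in ?subst_out // K'inM ?a_layer.
have glue x y s : x \in M -> y \in M -> x j = t -> y j = t -> s \in nodes (H i) ->
    dist (H i) (x i) s + dist (H i) s (y i) = dist (H i) (x i) (y i) ->
  projection M s t.
  move=> xM yM xj yj sN bs; have [w wM wi] := full_i s sN.
  have [m mM med] := closedM xM yM wM; apply/projectionP; exists m; split=> //.
    have := med i; rewrite wi => mi; apply: (median_between _ _ _ _ _ mi bs) => //;
    exact/nodeK/inK.
  have := med j; rewrite xj yj => /and3P[/eqP mj _ _].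
  by apply: between_self mj => //; apply/nodeK/inK.
split=> [|s y sy /projectionP[x [xM xi xj]]|s y y' ny sy sy'].
- by have [w wM [wi wj]] := full_j; apply/projectionP; exists w.
- have [w wM [wi wj]] := full_j; have yN := edge_nodesr (low_edge sy).
  have sN := edge_nodes (low_edge sy).
  apply: (glue x w) => //; rewrite xi wi (dist_edge (conH i) (low_edge sy)).
  rewrite (distC (conH i) yN pN) (distC (conH i) sN pN).
  by rewrite (low_level (frame_H i) pN sy).
case/projectionP=> x [xM xi xj] /projectionP[x' [xM' xi' xj']].
have sN := edge_nodes (low_edge sy).
apply: (glue x x') => //; rewrite xi xi'; have e := low_edge sy'.
have e' : edge (H i) y s by rewrite edge_sym (low_edge sy).
rewrite (dist2 (conH i) (frame_modular (frame_H i)) e' e ny).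
by rewrite !(dist_edge (conH i)).
Qed.

Lemma projectionC i j (s : T i) (t : T j) : projection M s t = projection M t s.
Proof. by apply: eq_existsb => x; rewrite [(x i == s) && _]andbC. Qed.

Lemma closed_projection i j : i != j ->
  closed_rel (H i) (H j) (a j i) (a i j) (fun s t => projection M s t).
Proof.
move=> nij; split=> [s t /projectionP[x [xM <- <-]]|s sN|t tN].
- by split; apply: nodeK; apply/(subsetP MK).
- have nji : j != i by rewrite eq_sym.
  have [b d m] := projection_good nji sN.
  by split=> [|t z|t z z']; rewrite !(projectionC s) //; [exact: d | exact: m].
- exact: projection_good.
Qed.

End Projections.

(** By induction on [I], some node of [K'] agrees with [x] on [I]. Take nodes agreeing with [x] on
    [I :\ i], on [I :\ j] and on [i, j]: at each coordinate in [I] two of the three agree with [x],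
    hence so does their median. *)
Lemma mem_by_projections x : x \in nodes K ->
    (forall i j, i != j -> projection (nodes K') (x i) (x j)) ->
  x \in nodes K'.
Proof.
move=> xN xP.
have closedK' := isometric_median_closed conH isometric_K' modular_K'.
suffices: exists2 y, y \in nodes K' & {in setT, forall i, y i = x i}.
  case=> y yK eq_xy; suffices <-: y = x by [].
  by apply/ffunP=> i; apply: eq_xy; rewrite inE.
move: {2}#|_| (erefl #|[set: 'I_k]|) => n; move: setT => I.
elim: n I => [|n IHn] I cI.
  case: isometric_K' => [[/set0Pn[y yK] _] _ _]; exists y => // i.
  by rewrite (cards0_eq cI) inE.
have [i iI] : exists i, i \in I by apply/card_gt0P; rewrite cI.
have cD l : l \in I -> #|I :\ l| = n.
  by move=> lI; move: cI; rewrite (cardsD1 l) lI => -[].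
have [y1 y1K y1P] := IHn _ (cD _ iI).
have [I1|[j]] := set_0Vmem (I :\ i).
  (* A single coordinate can be prescribed thanks to the full layer. *)
  exists (subst (a i) (x i)) => [|l lI]; first by apply/a_layer/nodeK.
  have [->|nli] := eqVneq l i; first by rewrite subst_in.
  by have := in_set0 l; rewrite -I1 !inE nli lI.
rewrite in_setD1 => /andP[nji jI]; have [y2 y2K y2P] := IHn _ (cD _ jI).
have nij : i != j by rewrite eq_sym.
have /projectionP[y3 [y3K y3i y3j]] := xP i j nij.
have [m mK med] := closedK' _ _ _ y1K y2K y3K; exists m => // l lI.
have [mN lN] := (nodeK l (sub_nodes mK), nodeK l xN).
have /and3P[/eqP m1 /eqP m2 /eqP m3] := med l.
have [eq_li|nli] := eqVneq l i.
  subst l; have y2i : y2 i = x i by apply: y2P; rewrite !inE nij iI.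
  by rewrite y2i y3i in m2; apply: between_self m2.
have y1l : y1 l = x l by apply: y1P; rewrite !inE nli lI.
have [eq_lj|nlj] := eqVneq l j.
  by subst l; rewrite y1l y3j in m3; apply: between_self m3.
have y2l : y2 l = x l by apply: y2P; rewrite !inE nlj lI.
by rewrite y1l y2l in m1; apply: between_self m1.
Qed.



(** A retraction in the making: the image still may exceed [K']. *)
Definition folding (f : point -> point) : Prop :=
  [/\ {in nodes K, forall v, f v \in nodes K}, {in nodes K', forall v, f v = v}
    & forall u v, edge K u v -> edge K (f u) (f v)].

Lemma folding_iter f n : folding f -> folding (iter n f).
Proof.
case=> fN fK fe; elim: n => [|n [IHN IHK IHe]] /=; first by split.
by split=> [v /IHN/fN|v vK|u v /IHe/fe] //=; rewrite IHK ?fK.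
Qed.

Lemma folding_pdist f x y : folding f -> x \in nodes K -> y \in nodes K ->
  pdist H (f x) (f y) <= pdist H x y.
Proof.
case=> fN _ fe xN yN; rewrite -(dist_prod conH (fN _ xN) (fN _ yN)); apply: dist_min.
case/walkP: (pdist_walk conH xN yN) => p [pp lp <-].
apply/walkP; exists (map f p); rewrite last_map lp size_map; split=> //.
by rewrite path_map; apply: sub_path pp => u v; apply: fe.
Qed.

(** * Folding two coordinates of the product *)

Section Thickenings.
Variables i j : 'I_k.
Hypothesis nij : i != j.
Local Notation p := (a j i).
Local Notation q := (a i j).

Definition thickening n : T i -> T j -> bool :=
  iter n (thicken (H i) (H j) p q) (fun s t => projection (nodes K') s t).

Lemma base_nodes1 : p \in nodes (H i). Proof. exact/nodeK/sub_nodes. Qed.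
Lemma base_nodes2 : q \in nodes (H j). Proof. exact/nodeK/sub_nodes. Qed.
Local Notation pN := base_nodes1.
Local Notation qN := base_nodes2.

Lemma closed_thickening n : closed_rel (H i) (H j) p q (thickening n).
Proof.
elim: n => [|n IHn] /=; last by apply: closed_thick => //; [exact: pN | exact: qN].
apply: closed_projection => //; first exact: isometric_median_closed.
by apply/subsetP=> x; apply: sub_nodes.
Qed.

(** Each [descend] away from the base lowers the total level of the pair, and a pair with a base
    coordinate lies in every iterate. *)
Lemma thickening_all n s t : s \in nodes (H i) -> t \in nodes (H j) ->
  dist (H i) p s + dist (H j) q t <= n -> thickening n s t.
Proof.
elim: n s t => [|n IHn] s t sN tN.
  rewrite leqn0 addn_eq0 => /andP[/eqP d0 _].
  by rewrite -(dist_eq0 (conH i) pN sN d0) (closed_base1 (closed_thickening 0)).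
have [-> _|nsp] := eqVneq s p; first exact: closed_base1 (closed_thickening n.+1) _ tN.
have [-> _|ntq] := eqVneq t q; first exact: closed_base2 (closed_thickening n.+1) _ sN.
move=> le_n; apply/and4P; split=> //; apply: IHn => //.
- exact: (recede_nodes (frame_H j) qN).
- have := recede_level (frame_H j) qN tN ntq; lia.
- exact: (recede_nodes (frame_H i) pN).
- have := recede_level (frame_H i) pN sN nsp; lia.
Qed.

Lemma thickening_mono n s t : projection (nodes K') s t -> thickening n s t.
Proof.
move=> st; elim: n => [//|n IHn].
exact: (sub_thick (frame_H i) (frame_H j) pN qN (closed_thickening n) IHn).
Qed.

Definition fold_pair n x : point :=
  let u := fold_onto (H i) (H j) p q (thickening n) (x i, x j) in
  subst (subst x u.1) u.2.

Lemma fold_pair1 n x :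
  fold_pair n x i = (fold_onto (H i) (H j) p q (thickening n) (x i, x j)).1.
Proof. by rewrite /fold_pair subst_out // subst_in. Qed.

Lemma fold_pair2 n x :
  fold_pair n x j = (fold_onto (H i) (H j) p q (thickening n) (x i, x j)).2.
Proof. by rewrite /fold_pair subst_in. Qed.

Lemma fold_pair_out n x l : l != i -> l != j -> fold_pair n x l = x l.
Proof. by move=> nli nlj; rewrite /fold_pair !subst_out. Qed.

Lemma fold_pair_id n x : thickening n (x i) (x j) -> fold_pair n x = x.
Proof. by move=> st; rewrite /fold_pair fold_id //= !subst_id // subst_id. Qed.

Lemma fold_pair_nodes n x :
  x \in nodes K -> thickening n.+1 (x i) (x j) -> fold_pair n x \in nodes K.
Proof.
move=> xN st; have := fold_mem (frame_H i) (frame_H j) pN qN (closed_thickening n) st.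
by case: (closed_thickening n) => + _ _ => /[apply] -[uN vN]; rewrite !subst_nodes.
Qed.

Lemma fold_pair_edge n x y :
    thickening n.+1 (x i) (x j) -> thickening n.+1 (y i) (y j) ->
  edge K x y -> edge K (fold_pair n x) (fold_pair n y).
Proof.
move=> xt yt /prod_edgeP[xN yN [l el out]].
have [gxN gyN] := (fold_pair_nodes xN xt, fold_pair_nodes yN yt).
have adj_edge : (forall l', l' != i -> l' != j -> x l' = y l') ->
    adj2 (H i) (H j) (fold_onto (H i) (H j) p q (thickening n) (x i, x j))
      (fold_onto (H i) (H j) p q (thickening n) (y i, y j)) ->
  edge K (fold_pair n x) (fold_pair n y).
  rewrite /adj2 -!fold_pair1 -!fold_pair2 => same /orP[/andP[e /eqP eq]|/andP[/eqP eq e]].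
    apply/prod_edgeP; split=> //; exists i => // l' nl'; have [->//|nlj] := eqVneq l' j.
    by rewrite !fold_pair_out // same.
  apply/prod_edgeP; split=> //; exists j => // l' nl'; have [->//|nli] := eqVneq l' i.
  by rewrite !fold_pair_out // same.
have [eq_li|nli] := eqVneq l i.
  subst l; apply: adj_edge => [l' nl' _|]; first exact: out.
  rewrite -(out j) 1?eq_sym // in yt *.
  exact: (fold_edge1 (frame_H i) (frame_H j) pN qN (closed_thickening n) el xt yt).
have [eq_lj|nlj] := eqVneq l j.
  subst l; apply: adj_edge => [l' _ nl'|]; first exact: out.
  rewrite -(out i) // in yt *.
  exact: (fold_edge2 (frame_H i) (frame_H j) pN qN (closed_thickening n) el xt yt).
apply/prod_edgeP; split=> //; exists l; first by rewrite !fold_pair_out.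
move=> l' nl'; have [->|nli'] := eqVneq l' i; first by rewrite !fold_pair1 !out // eq_sym.
have [->|nlj'] := eqVneq l' j; first by rewrite !fold_pair2 !out // eq_sym.
by rewrite !fold_pair_out // out.
Qed.

End Thickenings.

(** * The image of an idempotent folding *)

Section Image.
Variable f : point -> point.
Hypotheses (foldf : folding f) (idf : forall x, f (f x) = f x).
Let R : {set point} := f @: nodes K.

Lemma image_fix x : x \in R -> f x = x.
Proof. by case/imsetP=> y _ ->. Qed.

Lemma image_sub : R \subset nodes K.
Proof. by case: foldf => fN _ _; apply/subsetP=> _ /imsetP[y yN ->]; apply: fN. Qed.

Lemma image_K' : nodes K' \subset R.
Proof.
case: foldf => _ fK _; apply/subsetP=> x xK.
by rewrite -(fK x xK) imset_f // sub_nodes.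
Qed.

(** The map [f] fixes the three nodes and does not increase distances, so it sends their median in
    the product to a median again. *)
Lemma image_median_closed : median_closed H R.
Proof.
move=> x y z xR yR zR.
have RN u : u \in R -> u \in nodes K by apply/subsetP/image_sub.
have [xN yN zN] := And3 (RN x xR) (RN y yR) (RN z zR).
have /fin_all_exists2[m0 m0N m0P] i :
    exists2 u, u \in nodes (H i) & median (H i) (x i) (y i) (z i) u.
  by apply: frame_modular => //; apply: nodeK.
pose m : point := [ffun i => m0 i]; have mN : m \in nodes K.
  by apply/prod_nodesP=> i; rewrite ffunE.
have fmN : f m \in nodes K by case: foldf => fN _ _; apply: fN.
exists (f m) => [|i]; first exact: imset_f.
have btw u v : u \in R -> v \in R -> u \in nodes K -> v \in nodes K ->
    (forall i, dist (H i) (u i) (m i) + dist (H i) (m i) (v i)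
      = dist (H i) (u i) (v i)) ->
  dist (H i) (u i) (f m i) + dist (H i) (f m i) (v i) = dist (H i) (u i) (v i).
  move=> uR vR uN vN uv; move: i; apply: (sum_between conH) => //.
  have -> : pdist H u v = pdist H u m + pdist H m v.
    by rewrite /pdist -big_split; apply: eq_bigr => i _; rewrite /= uv.
  by rewrite leq_add // -{1}(image_fix uR, image_fix vR); apply: folding_pdist.
have m0m l : median (H l) (x l) (y l) (z l) (m l) by rewrite ffunE.
apply/and3P; split; apply/eqP; apply: btw => // l;
  by have /and3P[/eqP m1 /eqP m2 /eqP m3] := m0m l.
Qed.

(* A step of a geodesic towards v cannot stay over (x i, x j) by the minimality
   of pdist x w, so it must change the coordinate j. *)
Lemma image_slide i j x w v : i != j -> x \in R -> w \in R -> v \in R ->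
    edge (H j) (x j) (w j) -> v i = x i -> v j = w j ->
    (forall x', x' \in R -> x' i = x i -> x' j = x j -> pdist H x w <= pdist H x' w) ->
  subst x (w j) \in R.
Proof.
move=> nij xR wR vR exw vi vj minx.
have inK y : y \in R -> y \in nodes K by apply/subsetP/image_sub.
have [xN wN vN] := And3 (inK x xR) (inK w wR) (inK v vR).
(* This median lies over [(x i, w j)] and between [x] and [w]; replacing the coordinate [j] of [x]
   by [w j] is a step towards it. *)
have [m mR med] := image_median_closed vR xR wR; have mN := inK m mR.
have mi : m i = x i.
  have /and3P[/eqP m1 _ _] := med i; rewrite vi in m1.
  by apply: between_self m1; rewrite ?nodeK.
have mj : m j = w j.
  have /and3P[_ _ /eqP m3] := med j; rewrite vj in m3.
  by apply: between_self m3; rewrite ?nodeK.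
set x1 := subst x (w j); have e1 : edge K x x1 by apply: subst_edge.
have [fN _ fe] := foldf; have x1N := edge_nodesr e1; have fx1N := fN _ x1N.
have e2 : edge K x (f x1) by rewrite -{1}(image_fix xR); apply: fe.
have dx1 : pdist H x m = (pdist H x1 m).+1.
  rewrite -addn1 (@pdist_subst _ _ H x m j (w j) 1) //.
  by rewrite mj distxx add0n (dist_edge (conH j)).
have btw l : dist (H l) (x l) (f x1 l) + dist (H l) (f x1 l) (m l)
    = dist (H l) (x l) (m l).
  move: l; apply: (sum_between conH) => //.
  rewrite (pdist_edge conH e2) dx1 add1n ltnS.
  by have := folding_pdist foldf x1N mN; rewrite (image_fix mR).
have fx1R : f x1 \in R by apply: imset_f.
have fx1i : f x1 i = x i.
  have := btw i; rewrite mi => b; apply: between_self b => //; exact: nodeK.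
have closer : pdist H (f x1) w < pdist H x w.
  have mw : pdist H x w = pdist H x m + pdist H m w.
    rewrite /pdist -big_split; apply: eq_bigr => l _ /=.
    by have /and3P[_ /eqP m2 _] := med l.
  rewrite mw dx1 addSn ltnS.
  apply: leq_trans (pdist_triangle conH fx1N mN wN) _; rewrite leq_add2r.
  by have := folding_pdist foldf x1N mN; rewrite (image_fix mR).
have fx1j : f x1 j != x j.
  by apply: contraL closer => /eqP eq_j; rewrite -leqNgt; apply: minx.
suffices -> : x1 = f x1 by [].
(* The edge from [x] to [f x1] changes one coordinate only, hence [j], and this one step towards [m]
   already reaches [m j = w j]. *)
have [_ _ [l el out]] := prod_edgeP _ _ _ e2.
have eq_jl : j = l by apply/eqP; apply: contraNT fx1j => /out ->.
subst l; apply/ffunP=> l; have [->|nlj] := eqVneq l j.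
  rewrite subst_in; have := btw j.
  rewrite mj (dist_edge (conH j) el) (dist_edge (conH j) exw).
  case=> d0; apply/esym; apply: (dist_eq0 (conH j)) => //; exact: nodeK.
by rewrite subst_out // out.
Qed.

(** Choose [x] over [(s, t)] and [w] over [(y, z)] in [R] at minimal distance. Then [image_slide]
    applies to [x] in both directions, and the median of the two resulting nodes and [w] is the
    required corner. *)
Lemma image_crossing i j (s y : T i) (t z : T j) : i != j ->
    edge (H i) s y -> edge (H j) t z ->
    projection R s t -> projection R s z -> projection R y t -> projection R y z ->
  exists x, [/\ x \in R, x i = s, x j = t & subst (subst x y) z \in R].
Proof.
move=> nij esy etz /projectionP[x0 [x0R x0i x0j]] /projectionP[v [vR vi vj]].
move=> /projectionP[v' [vR' vi' vj']] /projectionP[w0 [w0R w0i w0j]].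
have nji : j != i by rewrite eq_sym.
pose P (u : point * point) := [&& u.1 \in R, u.1 i == s & u.1 j == t]
  && [&& u.2 \in R, u.2 i == y & u.2 j == z].
have P0 : P (x0, w0) by rewrite /P /= x0R x0i x0j w0R w0i w0j !eqxx.
case: (arg_minnP (fun u => pdist H u.1 u.2) P0) => -[x w] /= /andP[].
case/and3P=> /= xR /eqP xi /eqP xj /and3P[/= wR /eqP wi /eqP wj] min_xw.
have minx x' : x' \in R -> x' i = x i -> x' j = x j -> pdist H x w <= pdist H x' w.
  move=> xR' xi' xj'; apply: (min_xw (x', w)).
  by rewrite /P /= xR' xi' xj' xi xj wR wi wj !eqxx.
have xz : subst x z \in R.
  by rewrite -wj; apply: (image_slide (v := v) nij) => //; rewrite ?xi ?xj ?wj.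
have xy : subst x y \in R.
  rewrite -wi; apply: (image_slide (v := v') nji) => //; rewrite ?xi ?xj ?wi //.
  by move=> x' xR' xj' xi'; apply: minx; rewrite ?xi ?xj.
have inK u l : u \in R -> u l \in nodes (H l).
  by move=> uR; apply/nodeK/(subsetP image_sub).
have [m mR med] := image_median_closed xz xy wR.
exists x; split=> //; suffices -> : subst (subst x y) z = m by [].
apply/ffunP=> l; apply/esym; have /and3P[/eqP m1 /eqP m2 /eqP m3] := med l.
have [eq_lj|nlj] := eqVneq l j.
  subst l; rewrite subst_in; rewrite subst_in wj in m3.
  by apply: between_self m3; rewrite ?inK // -wj inK.
rewrite subst_out //; have [eq_li|nli] := eqVneq l i.
  subst l; rewrite subst_in; rewrite subst_in wi in m2.
  by apply: between_self m2; rewrite ?inK // -wi inK.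
rewrite subst_out //; rewrite !subst_out // in m1.
by apply: between_self m1; rewrite ?inK.
Qed.

Lemma image_shrink : ~~ (R \subset nodes K') ->
  exists2 h, folding h & #|h @: nodes K| < #|R|.
Proof.
case/subsetPn=> x0 x0R x0K'.
have RN x : x \in R -> x \in nodes K by apply/subsetP/image_sub.
have [i [j [nij nx0]]] : exists i j, i != j /\ ~~ projection (nodes K') (x0 i) (x0 j).
  have [/existsP[i /existsP[j /andP[nij nx0]]]|no] :=
    boolP [exists i, exists j, (i != j) && ~~ projection (nodes K') (x0 i) (x0 j)].
    by exists i, j.
  case/negP: x0K'; apply: mem_by_projections => [|i j nij]; first exact: RN.
  apply: contraR no => nx0; apply/existsP; exists i; apply/existsP; exists j.
  by rewrite nij.
pose p := a j i; pose q := a i j.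
have [pN qN] : p \in nodes (H i) /\ q \in nodes (H j) by rewrite base_nodes1 base_nodes2.
pose inR n := [forall x in R, @thickening i j n (x i) (x j)].
(* The iterate 0 misses the projection of [x0], while a large one covers all of [R]. *)
have [n nRn Rn] : exists2 n, ~~ inR n & inR n.+1.
  have inR_big : exists n, inR n.
    exists (\max_(x in R) (dist (H i) p (x i) + dist (H j) q (x j))).
    apply/forall_inP=> x xR; apply: thickening_all => //; try exact/nodeK/RN.
    by rewrite (bigD1 x) //= leq_maxl.
  case: (ex_minnP inR_big) => -[|n] Rn min_n.
    by case/negP: nx0; apply: (forall_inP Rn).
  by exists n => //; apply/negP=> /min_n; rewrite ltnn.
pose B := @thickening i j n; have closedB := closed_thickening nij n.
pose lev (x : point) := dist (H i) p (x i) + dist (H j) q (x j).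
have [x1 x1R nBx1] : exists2 x, x \in R & ~~ B (x i) (x j).
  by move: nRn; rewrite negb_forall_in => /exists_inP.
pose P (x : point) := (x \in R) && ~~ B (x i) (x j).
have P1 : P x1 by rewrite /P x1R.
(* For a node of [R] outside [B] of least total level, lowering either coordinate leads to a pair of
   [B]. *)
case: (arg_minnP lev P1) => x /andP[xR nB] min_x.
have {}min_x (s : T i) (t : T j) :
  projection R s t -> dist (H i) p s + dist (H j) q t < lev x -> B s t.
  case/projectionP=> x' [xR' <- <-] lt; apply: contraTT lt => nB'.
  by rewrite -leqNgt; apply: min_x; rewrite /P xR'.
have thickx : thicken (H i) (H j) p q B (x i) (x j) by apply: (forall_inP Rn).
have [nsp ntq] := thick_neq closedB thickx nB.
have [xiN xjN] := (nodeK i (RN _ xR), nodeK j (RN _ xR)).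
have [y sy] := low_exists (frame_H i) pN xiN nsp.
have [z tz] := low_exists (frame_H j) qN xjN ntq.
have closedR := closed_projection image_median_closed image_K' image_sub nij.
have Rst : projection R (x i) (x j) by apply/projectionP; exists x.
have Rsz := closed_col closedR tz Rst; have Ryt := closed_row closedR sy Rst.
have Ryz := closed_row closedR sy Rsz.
have Byt : B y (x j) by apply: min_x; rewrite // ltn_add2r low_lt.
have Bsz : B (x i) z by apply: min_x; rewrite // ltn_add2l low_lt.
have Byz := closed_row closedB sy Bsz.
have esub := sub_thick (frame_H i) (frame_H j) pN qN closedB.
(* The pairs [(y, x j)] and [(x i, z)] are fixed, so the image is adjacent to both; of their common
   neighbours [(x i, x j)] and [(y, z)] only the latter is in [B]. *)
have fold_x : fold_onto (H i) (H j) p q B (x i, x j) = (y, z).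
  have := fold_mem (frame_H i) (frame_H j) pN qN closedB thickx.
  have := fold_edge1 (frame_H i) (frame_H j) pN qN closedB (low_edge sy) thickx (esub _ _ Byt).
  have := fold_edge2 (frame_H i) (frame_H j) pN qN closedB (low_edge tz) thickx (esub _ _ Bsz).
  rewrite (fold_id _ _ _ _ Byt) (fold_id _ _ _ _ Bsz).
  case: (fold_onto _ _ _ _ _ _) => u v; rewrite /adj2 /=.
  case/orP=> /andP[e1 e2]; case/orP=> /andP[e3 e4] Buv.
  - by move: e4 e2 (edge_neq (low_edge tz)) => /eqP -> /eqP ->; rewrite eqxx.
  - by rewrite (eqP e2) (eqP e3).
  - by case/negP: nB; rewrite (eqP e1) (eqP e4) in Buv.
  - by move: e1 e3 (edge_neq (low_edge sy)) => /eqP -> /eqP ->; rewrite eqxx.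
(* The two nodes [x2] and [x3] of [R] will be identified by [g]. *)
have [x2 [x2R x2i x2j x3R]] :=
  image_crossing nij (low_edge sy) (low_edge tz) Rst Rsz Ryt Ryz.
pose g := @fold_pair i j n; set x3 := subst (subst x2 y) z in x3R.
have gx2 : g x2 = x3 by rewrite /g /fold_pair x2i x2j fold_x.
have gx3 : g x3 = x3.
  by apply: fold_pair_id => //; rewrite /x3 subst_in subst_out // subst_in.
have nx23 : x2 != x3.
  apply: contraTneq (edge_neq (low_edge tz)) => eq_x.
  by rewrite negbK -x2j eq_x /x3 subst_in.
have [fN fK fe] := foldf.
have thickR v : v \in nodes K -> @thickening i j n.+1 (f v i) (f v j).
  by move=> vN; apply: (forall_inP Rn); apply: imset_f.
exists (g \o f).
  split=> [v vN|v vK|u v euv] /=.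
  - by apply: fold_pair_nodes; rewrite ?fN ?thickR.
  - rewrite fK //; apply: fold_pair_id => //; apply: thickening_mono => //.
    by apply/projectionP; exists v.
  - by apply: fold_pair_edge; rewrite ?fe // thickR // (edge_nodes euv, edge_nodesr euv).
rewrite imset_comp ltn_neqAle leq_imset_card andbT.
apply: contraNN nx23 => /imset_injP inj_g; apply/eqP/inj_g => //.
by rewrite gx2 gx3.
Qed.

End Image.

(** Induction on the size of the image: passing to an idempotent iterate does not enlarge it, and
    [image_shrink] makes it smaller until it lies in [K']. *)
Lemma folding_retraction f :
  folding f -> exists g, retraction K K' g.
Proof.
have [n] := ubnP #|f @: nodes K|; elim: n f => // n IHn f; rewrite ltnS => le_n foldf.
have [m idm] := iter_idempotent f; pose h := iter m.+1 f.
have foldh : folding h by apply: folding_iter.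
have le_hf : #|h @: nodes K| <= #|f @: nodes K|.
  apply/subset_leq_card/subsetP=> _ /imsetP[x xN ->].
  have [fN _ _] := folding_iter m foldf.
  by rewrite /h iterS imset_f // fN.
have [sub|nsub] := boolP (h @: nodes K \subset nodes K'); last first.
  have [h' foldh' lt] := image_shrink foldh idm nsub.
  by apply: IHn foldh'; apply: leq_trans lt (leq_trans le_hf le_n).
have [hN hK he] := foldh; exists h; split=> // [v vN|u v euv].
  exact: (subsetP sub _ (imset_f _ vN)).
have inK' w : w \in nodes K -> h w \in nodes K'.
  by move=> wN; apply: (subsetP sub _ (imset_f _ wN)).
have [uN vN] := (edge_nodes euv, edge_nodesr euv).
have [conK' _ distK'] := isometric_K'.
(* Nodes of [K'] adjacent in [K] are adjacent in [K'], since [K'] is isometric. *)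
rewrite -(dist1 conK') ?inK' // distK' ?inK' // (dist_prod conH) ?hN //.
by rewrite (pdist_edge conH) ?he.
Qed.

End Retract.

(** The coordinate [i] is injective on the layer, which has as many nodes as [H i], so it takes
    every value in [nodes (H i)]. *)
Lemma full_layer (k : nat) (T : 'I_k -> finType) (H : forall i, graph (T i))
    (K' : graph {dffun forall i : 'I_k, T i}) i t :
    subgraph K' (cartesian_product H) -> isomorphic (layer K' i t) (H i) ->
  forall u, u \in nodes (H i) -> subst t u \in nodes K'.
Proof.
case=> /subsetP sK _ [f [inj_f im_f _]] u uN; set L := nodes (layer K' i t) in inj_f im_f.
have LP s : s \in L -> s \in nodes K' /\ forall j, j != i -> s j = t j.
  rewrite !inE => /andP[sK' /forall_inP st]; by split=> // j /st /eqP.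
pose e (s : {dffun forall i : 'I_k, T i}) := s i.
have inj_e : {in L &, injective e}.
  move=> s s' /LP[_ sP] /LP[_ sP'] eq_i; apply/ffunP=> j.
  by have [->|nji] := eqVneq j i; [exact: eq_i | rewrite sP ?sP'].
have /eqP im_e : e @: L == nodes (H i).
  rewrite eqEcard (card_in_imset inj_e) -(card_in_imset inj_f) im_f leqnn andbT.
  by apply/subsetP=> _ /imsetP[s /LP[/sK /prod_nodesP sN _] ->]; apply: sN.
move: uN; rewrite -im_e => /imsetP[s /LP[sK' sP] ->].
suffices -> : subst t (e s) = s by [].
apply/ffunP=> j; have [->|nji] := eqVneq j i; first by rewrite subst_in.
by rewrite subst_out // sP.
Qed.

Unset Implicit Arguments.

Theorem theorem4 (k : nat) (T : 'I_k -> finType) (H : forall i : 'I_k, graph (T i))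
    (K' : graph {dffun forall i : 'I_k, T i})
    (frame_H : forall i : 'I_k, frame (H i))
    (isometric_K' : isometric_subgraph K' (cartesian_product H))
    (modular_K' : modular K')
    (layers_K' : forall i : 'I_k,
       exists2 t, t \in nodes K' & isomorphic (layer K' i t) (H i)) :
  exists g : {dffun forall i : 'I_k, T i} -> {dffun forall i : 'I_k, T i},
    retraction (cartesian_product H) K' g.
Proof.
have [_ subK' _] := isometric_K'.
have [a aK a_iso] := fin_all_exists2 layers_K'.
have a_layer i : forall u, u \in nodes (H i) -> subst (a i) u \in nodes K'.
  exact: full_layer (a_iso i).
have fold1 : folding H K' id by split.
exact (folding_retraction frame_H isometric_K' modular_K' aK a_layer fold1).
Qed.
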